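(* Let $\widetilde{x},\widetilde{y}\in\ell^2$ with $p_k(\widetilde{x})=p_k(\widetilde{y})$ for all integers $k\geq 2$. Let $x$ and $y$ denote the (finite or infinite) sequences obtained from $\widetilde{x}$ and $\widetilde{y}$, respectively, by deleting all coordinates equal to $0$. Then, after embedding $x\mapsto(x,0,0,\ldots)$ and $y\mapsto(y,0,0,\ldots)$ (i.e. padding with zeros when the sequence is finite), $x$ and $y$ lie in the same orbit of $\mathcal{S}_\infty$.
   Context: $\ell^2$ is the space of real square-summable sequences indexed by the positive integers $\mathbb{N}$. For $k\geq 2$ and $x\in\ell^2$, $p_k(x)=\sum_{i=1}^\infty x_i^k$. $\mathcal{S}_\infty=\{\vartheta:\mathbb{N}\to\mathbb{N}\mid\vartheta\text{ bijective}\}$ is the large infinite symmetric group, acting on sequences by permuting coordinates. *)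

(* Defs.v *)
From HB Require Import structures.
From mathcomp Require Import all_boot all_order all_algebra.
From mathcomp Require Import all_classical all_reals all_analysis.
Set Implicit Arguments.
Unset Strict Implicit.
Unset Printing Implicit Defensive.
Import Order.TTheory GRing.Theory Num.Theory numFieldNormedType.Exports.
Local Open Scope classical_set_scope.
Local Open Scope ring_scope.

(* Sequences are indexed by [nat]: index [i] stands for the positive integer
   [i.+1]. *)

Definition ell2 (R : realType) : set (nat -> R) :=
  [set x : nat -> R | cvgn (series (fun i => x i ^+ 2))].
Arguments ell2 R : clear implicits.

(* [limn] is a total operator; for [x] in [ell2 R] and [2 <= k] the series
   converges absolutely, so this is its actual sum. *)
Definition power_sum (R : realType) (k : nat) (x : nat -> R) : R :=
  limn (series (fun i => x i ^+ k)).

Definition nonzero_before (R : realType) (x : nat -> R) (m : nat) : nat :=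
  count (fun i => x i != 0) (iota 0 m).

(* A finite or infinite sequence is encoded as a map [nat -> option R], [None]
   being the value at the positions past the end. The [n]-th term is [x m] for
   the unique [m] such that [x m != 0] and exactly [n] nonzero coordinates
   precede it, if there is such an [m]. *)
Definition delete_zeros (R : realType) (x : nat -> R) : nat -> option R :=
  fun n => xget None
    [set Some (x m) | m in [set m | x m != 0 /\ nonzero_before x m = n]].

Definition pad_zeros (R : realType) (s : nat -> option R) : nat -> R :=
  fun n => odflt 0 (s n).

Definition same_orbit (R : realType) (x y : nat -> R) : Prop :=
  exists2 theta : nat -> nat, bijective theta & y = x \o theta.

Lemma nonzero_before_inj (R : realType) (x : nat -> R) (m m' : nat) :
  x m != 0 -> x m' != 0 -> nonzero_before x m = nonzero_before x m' -> m = m'.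
Proof.
wlog lemm' : m m' / (m <= m')%N => [hwlog xm xm' e|xm xm'].
  case/orP: (leq_total m m') => h; first exact: hwlog.
  by apply/esym/hwlog.
move: lemm'; rewrite leq_eqVlt => /orP[/eqP //|ltmm'].
have -> : m' = (m.+1 + (m' - m.+1))%N by rewrite subnKC.
rewrite /nonzero_before iotaD count_cat -[in iota 0 m.+1]addn1 iotaD count_cat /=.
by rewrite add0n xm addn0 -addnA => /eqP; rewrite -{1}[count _ _]addn0 eqn_add2l.
Qed.

Lemma delete_zerosE (R : realType) (x : nat -> R) (m : nat) :
  x m != 0 -> delete_zeros x (nonzero_before x m) = Some (x m).
Proof.
move=> xm; apply: xget_unique; first by exists m.
by move=> _ [m' [xm' /nonzero_before_inj e] <-]; rewrite (e xm' xm).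
Qed.

Lemma delete_zeros_None (R : realType) (x : nat -> R) (n : nat) :
  (forall m, x m != 0 -> nonzero_before x m <> n) -> delete_zeros x n = None.
Proof. by move=> h; apply: xgetPN => v [m [xm /(h m xm)]]. Qed.

(* Main.v *)
Require Import Defs.
From HB Require Import structures.
From mathcomp Require Import all_boot all_order all_algebra.
From mathcomp Require Import all_classical all_reals all_analysis.
From mathcomp Require Import ring lra.
Set Implicit Arguments.
Unset Strict Implicit.
Unset Printing Implicit Defensive.
Import Order.TTheory GRing.Theory Num.Theory numFieldNormedType.Exports.
Local Open Scope classical_set_scope.
Local Open Scope ring_scope.

(** Both sequences are determined, up to the order of their nonzero terms, by
    the multiplicities of the nonzero reals [a], so everything comes down to
    reading these multiplicities off the power sums.

    The power sums are the moments of the finite measure putting mass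
    [x i ^+ 2] at the point [x i]; they determine
    [\sum_i x i ^+ 2 * p.[x i]] for every polynomial [p]
    ([weighted_poly_sum_eq]). All the points of [x] and [y] lie in a bounded
    set, so for [C] large the polynomial [q = 1 - ('X - a) ^+ 2 / C] takes its
    values in [0, 1] there, and the value 1 at [a] only. The powers of [q]
    therefore decrease to the indicator function of [a]: an explicit
    approximation, which replaces the Weierstrass theorem. By dominated
    convergence for series ([tannery]), the sums weighted by [q ^+ n] tend to
    [a ^+ 2] times the multiplicity of [a] ([level_sum_lim],
    [level_sum_card]), and this common limit forces the multiplicities of [a]
    in [x] and [y] to agree ([power_sums_fiber]).

    It remains to see that equal multiplicities of the nonzero reals give a
    permutation of the sequences without zeros ([same_orbit_compress]). The
    zeros that padding puts back sit at the indices that are not the rank of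
    any nonzero coordinate, and these depend only on the cardinality of the
    support ([rank_imageP]). Hence 0 also has the same multiplicity in both
    padded sequences, and bijections between the fibers glue to a bijection of
    the indices ([fiberwise_bij]). *)

(** * Dominated convergence for series *)

Section DominatedSeries.
Variable R : realType.
Implicit Types u v : nat -> R.

Lemma dominated_series_cvg u v :
  (forall i, `|u i| <= v i) -> cvgn (series v) -> cvgn (series u).
Proof.
move=> uv cv; apply: (@normed_cvg _ R).
apply: (series_le_cvg _ _ _ cv) => i //=.
by apply: le_trans (uv i); exact: normr_ge0.
Qed.

(** Comparing tails rather than whole sums gives [tannery] a bound that is
    uniform in the first index of the family. *)
Lemma dominated_series_tail u v N :
  (forall i, `|u i| <= v i) -> cvgn (series v) ->
  `|limn (series u) - series u N| <= limn (series v) - series v N.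
Proof.
move=> uv cv; have cu := dominated_series_cvg uv cv.
have du : (fun m => `|series u m - series u N|) @ \oo -->
    `|limn (series u) - series u N|.
  by apply: cvg_norm; apply: cvgB => //; exact: cvg_cst.
have dv : (fun m => series v m - series v N) @ \oo -->
    limn (series v) - series v N.
  by apply: cvgB => //; exact: cvg_cst.
apply: ler_cvg_to du dv _; near=> m.
have Nm : (N <= m)%N by near: m; exact: nbhs_infty_ge.
rewrite !sub_series_geq//; apply: (le_trans (ler_norm_sum _ _ _)).
exact: ler_sum.
Unshelve. all: by end_near. Qed.

(** Tannery's theorem. A fixed tail of the dominating series controls the
    tails of all the series at once, and what is left is a finite sum, whose
    limit is taken term by term. *)
Lemma tannery (f : nat -> nat -> R) (g v : nat -> R) :
  (forall n i, `|f n i| <= v i) -> cvgn (series v) ->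
  (forall i, f ^~ i @ \oo --> g i) ->
  (fun n => limn (series (f n))) @ \oo --> limn (series g).
Proof.
move=> fv cv fg.
have gv i : `|g i| <= v i.
  have cf : `|f n i| @[n --> \oo] --> `|g i| by exact: cvg_norm (fg i).
  rewrite -(cvg_lim (@Rhausdorff R) cf).
  by apply: limr_le (cvgP _ cf) _; near=> n; exact: fv.
have head N : (fun n => series (f n) N) @ \oo --> series g N.
  elim: N => [|N IH].
    rewrite {2}/series /= big_geq//.
    under eq_fun do rewrite /series /= big_geq//.
    exact: cvg_cst.
  rewrite seriesSr; under eq_fun do rewrite seriesSr.
  exact: cvgD.
apply/cvgrPdist_lt => e e0.
have e3 : 0 < e / 3 by rewrite divr_gt0.
have [N _ tail] := (cvgrPdist_lt _ _).1 cv _ e3.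
have {}tail : limn (series v) - series v N < e / 3.
  by apply: le_lt_trans (tail N _) => //=; exact: ler_norm.
near=> n.
have hd : `|series g N - series (f n) N| < e / 3.
  by near: n; exact: ((cvgrPdist_lt _ _).1 (head N) _ e3).
have tg := dominated_series_tail N gv cv.
have tf := dominated_series_tail N (fv n) cv.
rewrite (_ : _ - _ = (limn (series g) - series g N)
   + (series g N - series (f n) N)
   - (limn (series (f n)) - series (f n) N)); last by ring.
apply: (le_lt_trans (ler_normB _ _)).
have := ler_normD (limn (series g) - series g N) (series g N - series (f n) N).
lra.
Unshelve. all: by end_near. Qed.
End DominatedSeries.

(** * Ranks in a set of natural numbers *)

(** For [P i] the condition [x i != 0] this is [nonzero_before x], up to
    conversion; the same function also counts the occurrences of a value. *)
Definition rank (P : pred nat) (m : nat) : nat := count P (iota 0 m).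

Lemma rankS (P : pred nat) m : rank P m.+1 = (rank P m + P m)%N.
Proof. by rewrite /rank -addn1 iotaD count_cat /= addn0 add0n. Qed.

Lemma rank_lt (P : pred nat) m n : P m -> (m < n)%N -> (rank P m < rank P n)%N.
Proof.
move=> Pm; elim: n => // n IH; rewrite ltnS leq_eqVlt rankS.
move=> /orP[/eqP <-|/IH].
  by rewrite Pm addn1.
by move=> h; apply: leq_trans h (leq_addr _ _).
Qed.

Lemma rank_inj (P : pred nat) : {in [set m | P m] &, injective (rank P)}.
Proof.
move=> m n; rewrite !inE /= => Pm Pn e.
case: (ltngtP m n) => // h; [have := rank_lt Pm h|have := rank_lt Pn h].
all: by rewrite e ltnn.
Qed.

(** The rank grows by steps of at most one, hence skips no value. *)
Lemma rank_onto (P : pred nat) m k : (k < rank P m)%N ->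
  exists2 n, (n < m)%N & P n /\ rank P n = k.
Proof.
elim: m => // m IH; rewrite rankS; case: (ltnP k (rank P m)) => [/IH[n nm h] _|].
  by exists n => //; exact: ltnW.
case Pm : (P m) => le1 le2; last by move: le2; rewrite addn0 ltnNge le1.
exists m => //; split=> //.
by apply/eqP; rewrite eqn_leq le1 /=; move: le2; rewrite addn1 ltnS.
Qed.

Lemma card_bounded (P : pred nat) N : (forall i, P i -> (i < N)%N) ->
  ([set i | P i] #= `I_(rank P N))%card.
Proof.
move=> PN.
have -> : `I_(rank P N) = rank P @` [set i | P i].
  apply/seteqP; split=> [k /= /rank_onto[n _ [Pn <-]]|_ [n /= Pn <-]].
    by exists n.
  exact: rank_lt Pn (PN _ Pn).
by apply: card_esym; exact: inj_card_eq (@rank_inj P).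
Qed.

(** The ranks taken on [P] form an initial segment of the natural numbers in
    bijection with [P]. Stating this through [#<=] avoids separating finite
    from infinite [P]. *)
Lemma rank_imageP (P : pred nat) n :
  (rank P @` [set i | P i]) n <-> (`I_n.+1 #<= [set i | P i])%card.
Proof.
rewrite -(card_le_eqr (inj_card_eq (@rank_inj P))); split.
  move=> [m /= Pm <-]; apply: subset_card_le => k /=.
  rewrite ltnS leq_eqVlt => /orP[/eqP ->|/rank_onto[j _ [Pj <-]]].
    by exists m.
  by exists j.
move=> le; apply: contrapT => nin.
have : (`I_n.+1 #<= `I_n)%card.
  apply: card_le_trans le _; apply: subset_card_le => _ [m /= Pm <-].
  rewrite ltnNge; apply/negP; rewrite leq_eqVlt => /orP[/eqP e|/rank_onto].
    by apply: nin; exists m.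
  by move=> [j _ [Pj e]]; apply: nin; exists j.
by rewrite card_le_II ltnn.
Qed.

(** Choose a bijection between the fibers over each value; as the fibers
    partition [A] and [B], these bijections glue. *)
Lemma fiberwise_bij (T : choiceType) (f g : nat -> T) (A B : set nat) :
  (forall a, (A `&` f @^-1` [set a] #= B `&` g @^-1` [set a])%card) ->
  exists2 h : nat -> nat, set_bij A B h & {in A, f =1 g \o h}.
Proof.
move=> fib; have /choice[h hP] a := card_set_bijP (fib a).
exists (fun i => h (f i) i); last first.
  by move=> i; rewrite inE => Ai; have [/(_ i (conj Ai erefl)) [_ /= gi] _ _] := hP (f i).
split.
- by move=> i Ai; have [/(_ i (conj Ai erefl)) []] := hP (f i).
- move=> i j; rewrite !inE => Ai Aj e.
  have [/(_ i (conj Ai erefl)) [_ /= gi] _ _] := hP (f i).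
  have [/(_ j (conj Aj erefl)) [_ /= gj] _ _] := hP (f j).
  have fij : f i = f j by rewrite -gi -gj e.
  have [_ inj _] := hP (f i); apply: inj; rewrite ?inE; [by split|by split|].
  by rewrite e fij.
- move=> j Bj; have [_ _ /(_ j (conj Bj erefl)) [i [Ai /= fi] hi]] := hP (g j).
  by exists i => //; rewrite /= fi.
Qed.

(** * Sequences with their zeros deleted *)

Section Delete.
Variable R : realType.
Implicit Types x y : nat -> R.
Local Notation compress x := (pad_zeros (delete_zeros x)).
Local Notation nz x := [pred i | x i != 0 :> R].

Lemma compress_rank x m : x m != 0 -> compress x (rank (nz x) m) = x m.
Proof. by move=> xm; rewrite /pad_zeros (delete_zerosE xm). Qed.

Lemma compress_outside x n :
  ~ (rank (nz x) @` [set i | nz x i]) n -> compress x n = 0.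
Proof.
move=> nin; rewrite /pad_zeros delete_zeros_None// => m xm e.
by apply: nin; exists m.
Qed.

(** Deleting zeros and padding moves each occurrence of a nonzero value to
    its rank, and creates no new one. *)
Lemma compress_fiber x a : a != 0 ->
  (compress x @^-1` [set a] #= x @^-1` [set a])%card.
Proof.
move=> a0.
have -> : compress x @^-1` [set a] = rank (nz x) @` (x @^-1` [set a]).
  apply/seteqP; split=> [n /= xn|_ [m /= xm <-]]; last first.
    by rewrite compress_rank xm.
  have : (rank (nz x) @` [set i | nz x i]) n.
    by apply: contrapT => /compress_outside; rewrite xn => /eqP; apply/negP.
  move=> [m /= xm e]; exists m => //; by rewrite -xn -e compress_rank.
apply: inj_card_eq => m n; rewrite !inE /= => xm xn.
by apply: rank_inj; rewrite inE /= ?xm ?xn.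
Qed.

Lemma compress_fiber0 x :
  compress x @^-1` [set 0] = ~` (rank (nz x) @` [set i | nz x i]).
Proof.
apply/seteqP; split=> n /=; last exact: compress_outside.
by move=> xn [m /= xm e]; move: xn; rewrite -e compress_rank// => /eqP; apply/negP.
Qed.

(** The multiplicity of 0 may change when zeros are deleted, whence the
    detour through supports: they are equipotent by gluing the fibers over the
    nonzero values, so both padded sequences vanish on the same indices. A
    second gluing, over all values, gives the permutation. *)
Lemma same_orbit_compress x y :
  (forall a, a != 0 -> (x @^-1` [set a] #= y @^-1` [set a])%card) ->
  same_orbit (compress x) (compress y).
Proof.
move=> xy.
have supp : ([set i | nz x i] #= [set i | nz y i])%card.
  have [a|h hb _] := @fiberwise_bij R x y [set i | nz x i] [set i | nz y i];
    last by apply/card_set_bijP; exists h.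
  have [->|a0] := eqVneq a 0.
    rewrite (_ : _ `&` _ = set0); last by apply/seteqP; split=> i //= [/eqP].
    by rewrite (_ : _ `&` _ = set0)//; apply/seteqP; split=> i //= [/eqP].
  have E z : [set i | nz z i] `&` z @^-1` [set a] = z @^-1` [set a].
    by apply/seteqP; split=> i /=; [case|move=> ->].
  by rewrite !E xy.
have ranks : rank (nz x) @` [set i | nz x i] = rank (nz y) @` [set i | nz y i].
  apply/seteqP; split=> n /rank_imageP le; apply/rank_imageP.
    by rewrite -(card_le_eqr supp).
  by rewrite (card_le_eqr supp).
have [a|h hb eh] := @fiberwise_bij R (compress y) (compress x) setT setT.
  rewrite !setTI; have [->|a0] := eqVneq a 0.
    by rewrite !compress_fiber0 ranks.
  apply: card_eq_trans (compress_fiber _ a0) _.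
  by apply: card_eq_trans (card_esym (compress_fiber _ a0)); exact/card_esym/xy.
exists h; first by rewrite -setTT_bijective.
by apply/funext => i; apply: eh; rewrite inE.
Qed.
End Delete.

(** * Power sums determine multiplicities *)

Section PowerSums.
Variable R : realType.
Implicit Types x y : nat -> R.

Lemma ell2_bounded x i : ell2 R x -> x i ^+ 2 <= power_sum 2 x.
Proof.
move=> cx; have nd : {homo series (fun i => x i ^+ 2) : m n / (m <= n)%N >-> m <= n}.
  by apply: nondecreasing_series => j _ _; exact: sqr_ge0.
apply: le_trans (nondecreasing_cvgn_le nd cx i.+1).
by rewrite seriesSr lerDr sumr_ge0// => j _; exact: sqr_ge0.
Qed.

(** The terms of [x] are bounded, so those of the [k]-th power sum are at most
    a constant times [x i ^+ 2]. *)
Lemma ell2_power_cvg x k : ell2 R x -> (2 <= k)%N ->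
  cvgn (series (fun i => x i ^+ k)).
Proof.
move=> cx k2; set C := power_sum 2 x; set M := 1 + C.
have C0 : 0 <= C by apply: le_trans (ell2_bounded 0 cx); exact: sqr_ge0.
have xM i : `|x i| <= M.
  have := ell2_bounded i cx; rewrite -/C -real_normK ?num_real//.
  (* A real is at most one plus its square: no square root of [C] is needed. *)
  have := normr_ge0 (x i); rewrite /M; nra.
apply: (@dominated_series_cvg _ _ (M ^+ (k - 2) *: (fun i => x i ^+ 2))).
  move=> i; rewrite /GRing.scale /= -{1}(subnK k2) exprD normrM normrX.
  rewrite (ger0_norm (sqr_ge0 _)) ler_wpM2r ?sqr_ge0//.
  by rewrite lerXn2r ?nnegrE ?normr_ge0// (le_trans _ (xM i)).
exact: is_cvg_seriesZ.
Qed.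

(** The identity is linear in [p], and holds for monomials by hypothesis. In
    the induction on [p] the factor ['X] is absorbed by the power of [x i], so
    the exponent 2 has to be generalized. *)
Lemma weighted_poly_sum_eq x y : ell2 R x -> ell2 R y ->
  (forall k, (2 <= k)%N -> power_sum k x = power_sum k y) ->
  forall p : {poly R},
  limn (series (fun i => x i ^+ 2 * p.[x i])) =
  limn (series (fun i => y i ^+ 2 * p.[y i])).
Proof.
move=> hx hy hp.
suff gen (p : {poly R}) : forall k, (2 <= k)%N ->
  [/\ cvgn (series (fun i => x i ^+ k * p.[x i])),
      cvgn (series (fun i => y i ^+ k * p.[y i])) &
      limn (series (fun i => x i ^+ k * p.[x i])) =
      limn (series (fun i => y i ^+ k * p.[y i]))].
  by move=> p; have [] := gen p 2.
elim/poly_ind: p => [|p c IH] k k2.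
  have E z : (fun i : nat => z i ^+ k * (0 : {poly R}).[z i]) = cst 0.
    by apply/funext => i; rewrite horner0 mulr0.
  have c0 : cvgn (series (cst 0 : nat -> R)).
    by apply: (dominated_series_cvg _ hx) => i; rewrite normr0 sqr_ge0.
  by rewrite !E.
have E (z : nat -> R) : (fun i => z i ^+ k * (p * 'X + c%:P).[z i]) =
    (fun i => z i ^+ k.+1 * p.[z i]) + c *: (fun i => z i ^+ k).
  apply/funext => i; rewrite !hornerE.
  by rewrite [RHS](_ : _ = z i ^+ k.+1 * p.[z i] + c * z i ^+ k)// exprSr; ring.
have [cx cy e] := IH k.+1 (leqW k2).
have px := ell2_power_cvg hx k2; have py := ell2_power_cvg hy k2.
have sx := is_cvg_seriesZ (k := c) px; have sy := is_cvg_seriesZ (k := c) py.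
rewrite !E; split; try exact: is_cvg_seriesD.
rewrite !lim_seriesD// e !lim_seriesZ//; congr (_ + _ *: _); exact: hp.
Qed.

(** [1 - ('X - a) ^+ 2 / C] lies in [0, 1] at every [x i] and equals 1 only
    where [x i = a], so its powers tend there to the indicator of [a]; the
    series of the [x i ^+ 2] dominates. *)
Lemma level_sum_lim x (a C : R) : ell2 R x -> 0 < C ->
  (forall i, (x i - a) ^+ 2 <= C) ->
  (fun n => limn (series (fun i => x i ^+ 2 *
     ((1 - C^-1 *: ('X - a%:P) ^+ 2) ^+ n).[x i]))) @ \oo -->
  limn (series (fun i => x i ^+ 2 * (x i == a)%:R)).
Proof.
move=> cx C0 xC.
set q := fun t : R => 1 - C^-1 * (t - a) ^+ 2.
have qE n t : ((1 - C^-1 *: ('X - a%:P) ^+ 2) ^+ n).[t] = q t ^+ n.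
  by rewrite !hornerE /= -mulrA.
have q01 i : 0 <= q (x i) <= 1.
  rewrite subr_ge0 mulrC ler_pdivrMr// mul1r xC /= gerBl.
  by rewrite mulr_ge0 ?sqr_ge0// invr_ge0 ltW.
apply: (tannery (v := fun i => x i ^+ 2)) _ cx _ => [n i|i].
  have /andP[q0 q1] := q01 i.
  rewrite qE normrM (ger0_norm (sqr_ge0 _)) normrX (ger0_norm q0).
  by rewrite ler_piMr ?sqr_ge0// exprn_ile1.
under eq_fun do rewrite qE.
apply: cvgMr; have [->|xa] := eqVneq (x i) a.
  rewrite (_ : q a = 1); last by rewrite /q subrr expr0n mulr0 subr0.
  by rewrite (_ : _ 1 = cst 1); [exact: cvg_cst|apply/funext => n; rewrite expr1n].
apply: cvg_expr; have /andP[q0 _] := q01 i.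
rewrite ger0_norm// /q gtrBl mulr_gt0 ?invr_gt0//.
by rewrite exprn_even_gt0 //= subr_eq0.
Qed.

(** Since [x i] tends to 0, a nonzero value [a] occurs finitely often, and each
    occurrence contributes [a ^+ 2] to the limit in [level_sum_lim]. *)
Lemma level_sum_card x (a : R) : ell2 R x -> a != 0 ->
  exists n, (x @^-1` [set a] #= `I_n)%card /\
    limn (series (fun i => x i ^+ 2 * (x i == a)%:R)) = a ^+ 2 *+ n.
Proof.
move=> cx a0; pose P := [pred i | x i == a].
have [N PN] : exists N, forall i, P i -> (i < N)%N.
  have /cvgr0Pnorm_lt /(_ (a ^+ 2)) := cvg_series_cvg_0 cx.
  rewrite exprn_even_gt0//= => /(_ a0)[N _ xN]; exists N => i /eqP xia.
  rewrite ltnNge; apply/negP => /xN /=.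
  by rewrite xia ger0_norm ?sqr_ge0// ltxx.
have partial m : series (fun i => x i ^+ 2 * (x i == a)%:R) m = a ^+ 2 *+ rank P m.
  elim: m => [|m IH]; first by rewrite /series /= big_geq.
  rewrite seriesSr IH rankS mulrnDr; congr (_ + _).
  by rewrite /P /=; case: eqVneq => [->|_]; rewrite (mulr1, mulr0).
exists (rank P N); split.
  rewrite (_ : _ @^-1` _ = [set i | P i]); first exact: card_bounded.
  by apply/seteqP; split=> i /= /eqP.
apply: lim_near_cst => //; near=> m.
have Nm : (N <= m)%N by near: m; exact: nbhs_infty_ge.
rewrite partial; congr (_ *+ _); rewrite -(subnKC Nm).
elim: (m - N)%N => [|d IH]; first by rewrite addn0.
rewrite addnS rankS IH; case Pd : (P (N + d)%N); last by rewrite addn0.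
by have := PN _ Pd; rewrite ltnNge leq_addr.
Unshelve. all: by end_near. Qed.

(** One polynomial sequence isolates [a] in both [x] and [y], so the limits
    computed from [x] and from [y] are those of one and the same sequence. *)
Lemma power_sums_fiber x y (a : R) : ell2 R x -> ell2 R y ->
  (forall k, (2 <= k)%N -> power_sum k x = power_sum k y) -> a != 0 ->
  (x @^-1` [set a] #= y @^-1` [set a])%card.
Proof.
move=> hx hy hp a0.
have [m [xm xs]] := level_sum_card hx a0.
have [n [yn ys]] := level_sum_card hy a0.
(* From [(u - a) ^+ 2 <= 2 * (u ^+ 2 + a ^+ 2)]; both sequences have the same
   second power sum. *)
pose C := 2 * (power_sum 2 x + a ^+ 2).
have bound z i : ell2 R z -> power_sum 2 z = power_sum 2 x -> (z i - a) ^+ 2 <= C.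
  move=> hz e; have := ell2_bounded i hz; rewrite e /C.
  have := sqr_ge0 (z i + a); lra.
have C0 : 0 < C.
  have := ell2_bounded 0 hx; have := sqr_ge0 (x 0%N).
  have : 0 < a ^+ 2 by rewrite exprn_even_gt0.
  rewrite /C; lra.
have Lx := level_sum_lim hx C0 (fun i => bound x i hx erefl).
have Ly := level_sum_lim hy C0 (fun i => bound y i hy (esym (hp 2 isT))).
have : a ^+ 2 *+ m = a ^+ 2 *+ n.
  rewrite -xs -ys -(cvg_lim (@Rhausdorff R) Lx) -(cvg_lim (@Rhausdorff R) Ly).
  by congr (limn _); apply/funext => j; exact: weighted_poly_sum_eq.
move=> /mulrIn; rewrite expf_eq0 /= => /(_ a0) mn.
by apply: card_eq_trans xm _; rewrite mn card_esym.
Qed.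
End PowerSums.

Theorem proposition4p1 (R : realType) (xt yt : nat -> R)
  (hx : ell2 R xt) (hy : ell2 R yt)
  (hp : forall k : nat, (2 <= k)%N -> power_sum k xt = power_sum k yt) :
  same_orbit (pad_zeros (delete_zeros xt)) (pad_zeros (delete_zeros yt)).
Proof.
by apply: same_orbit_compress => a; exact: power_sums_fiber.
Qed.
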